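(* Let $M\ge 2$, $N=2M$, and let $\{\beta_k,B_k,L_k\}_{k=1}^N$ be juncture parameters of Type II-OEE, i.e. $$L_{k+M}=L_k,\qquad \beta_{k+M}=\beta_k,\qquad B_{k+M}=B_k\qquad (k=1,\dots,M),$$ satisfying the continuity constraints $\sum_{k=1}^{M}L_k\cos\beta_k=0$ and $\sum_{k=1}^{M}L_k\cos B_k=0$. Then the prismatic juncture with these parameters is flexible.
   Context: Juncture parameters: for an even integer $N\ge 4$, real numbers $L_k>0$ (edge lengths) and $\beta_k,B_k\in(0,\pi)$ (face angles), $k=1,\dots,N$; the index $k$ is cyclic mod $N$. For an angle $\theta\in(0,\pi/2)$ let $\mathbf u(\theta)=(-\sin\theta,-\cos\theta,0)$ and $\mathbf w(\theta)=(\sin\theta,-\cos\theta,0)$. A prismatic juncture at $\theta$ with the given parameters is a closed polygon $\mathbf v_1,\dots,\mathbf v_N\in\mathbb R^3$ ($\mathbf v_{N+1}=\mathbf v_1$) with, for every $k=1,\dots,N$, $$|\mathbf v_{k+1}-\mathbf v_k|=L_k,\quad (\mathbf v_{k+1}-\mathbf v_k)\cdot\mathbf u(\theta)=L_k\cos\beta_k,\quad (\mathbf v_{k+1}-\mathbf v_k)\cdot\mathbf w(\theta)=L_k\cos B_k .$$ Geometrically, two unbounded annular tubes meet along this polygon: one made of the half-strips $\{\mathbf p+s\mathbf u:\mathbf p\in[\mathbf v_k,\mathbf v_{k+1}],\ s\ge0\}$, the other of the half-strips $\{\mathbf p+s\mathbf w:\mathbf p\in[\mathbf v_k,\mathbf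 v_{k+1}],\ s\ge0\}$; $\beta_k$ and $B_k$ are the face angles at $\mathbf v_k$. Self-intersections are allowed. The juncture with given parameters is flexible, with $\theta$ as the variable of flexion, if there are an interval $I\subset(0,\pi/2)$ of positive length and continuous maps $\mathbf v_1,\dots,\mathbf v_N:I\to\mathbb R^3$ such that for every $\theta\in I$ the points $\mathbf v_1(\theta),\dots,\mathbf v_N(\theta)$ form a prismatic juncture at $\theta$ with these fixed parameters.
   Formalization: Added hypothesis: at some angle θ in (0,π/2) each edge on its own can be placed with its length and face angles, not in the plane of u and w. Without it the claim fails (for some parameters no juncture exists, or it exists at one θ only); every flexible juncture satisfies it. *)

(* Defs.v *)
From HB Require Import structures.
From mathcomp Require Import all_boot all_order all_algebra.
From mathcomp Require Import all_classical all_reals all_analysis.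

Set Implicit Arguments.
Unset Strict Implicit.
Unset Printing Implicit Defensive.

Import Order.TTheory GRing.Theory Num.Theory.
Import numFieldNormedType.Exports.

Local Open Scope classical_set_scope.
Local Open Scope ring_scope.

Definition dot3 (R : realType) (x y : 'rV[R]_3) : R :=
  \sum_(i < 3) x 0 i * y 0 i.

(* The library norm on 'rV[R]_3 is the sup norm, hence this definition. *)
Definition enorm3 (R : realType) (x : 'rV[R]_3) : R := Num.sqrt (dot3 x x).

Definition uvec (R : realType) (theta : R) : 'rV[R]_3 :=
  \row_(i < 3) [:: - sin theta; - cos theta; 0]`_i.

Definition wvec (R : realType) (theta : R) : 'rV[R]_3 :=
  \row_(i < 3) [:: sin theta; - cos theta; 0]`_i.

(* The index k = 1, ..., N is shifted to 0, ..., N - 1. *)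
Definition juncture_params (R : realType) (N : nat)
    (L beta B : 'I_N -> R) : Prop :=
  [/\ (4 <= N)%N, ~~ odd N, (forall k, 0 < L k),
      (forall k, 0 < beta k < pi) & (forall k, 0 < B k < pi)].

Definition edge_vector (R : realType) (theta l b b' : R) (e : 'rV[R]_3) : Prop :=
  [/\ enorm3 e = l,
      dot3 e (uvec theta) = l * cos b &
      dot3 e (wvec theta) = l * cos b'].

(* [ordS] is the cyclic successor, so the polygon is closed. *)
Definition prismatic_juncture (R : realType) (N : nat) (L beta B : 'I_N -> R)
    (theta : R) (v : 'I_N -> 'rV[R]_3) : Prop :=
  forall k, edge_vector theta (L k) (beta k) (B k) (v (ordS k) - v k).

(* At some theta, each edge taken on its own can be placed with its prescribed
   length and face angles so that its two half-strips are not coplanar; no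
   closing condition is imposed. Writing x = |beta k - B k| and
   y = min(beta k + B k, 2 pi - beta k - B k), this says that
   x < 2 theta < y for all k simultaneously: the strict triangle inequalities
   for a spherical triangle with sides beta k, B k and 2 theta. *)
Definition edges_realizable (R : realType) (N : nat)
    (L beta B : 'I_N -> R) : Prop :=
  exists2 theta : R, 0 < theta < pi / 2 &
    forall k, exists2 e : 'rV[R]_3,
      edge_vector theta (L k) (beta k) (B k) e &
      forall s t : R, e <> s *: uvec theta + t *: wvec theta.

(* The vertex maps are total functions of theta; only their values on the
   interval I matter. *)
Definition flexible (R : realType) (N : nat) (L beta B : 'I_N -> R) : Prop :=
  exists I : set R,
    [/\ is_interval I,
        I `<=` [set theta | 0 < theta < pi / 2],
        (exists a b : R, [/\ I a, I b & a < b]) &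
        exists v : 'I_N -> R -> 'rV[R]_3,
          (forall k, {within I, continuous (v k)}) /\
          (forall theta, I theta ->
             prismatic_juncture L beta B theta (fun k => v k theta))].

(* lshift M k and rshift M k are the indices k and k + M in 'I_(M + M). *)
Definition type_II_OEE (R : realType) (M : nat)
    (L beta B : 'I_(M + M) -> R) : Prop :=
  forall k : 'I_M,
    [/\ L (rshift M k) = L (lshift M k),
        beta (rshift M k) = beta (lshift M k) &
        B (rshift M k) = B (lshift M k)].

(* Main.v *)
Require Import Defs.
From HB Require Import structures.
From mathcomp Require Import all_boot all_order all_algebra.
From mathcomp Require Import all_classical all_reals all_analysis.
From mathcomp Require Import ring lra.

Import Order.TTheory GRing.Theory Num.Theory.
Import numFieldNormedType.Exports.

Local Open Scope classical_set_scope.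
Local Open Scope ring_scope.

(** The two scalar products and the length of an edge determine its first two
coordinates, which are linear in [L cos beta] and [L cos B], and its third
coordinate up to sign. By the continuity constraints, the first two coordinates
sum to zero over each half of the polygon; giving opposite signs to the third
coordinates of the edges [k] and [k + M] makes the whole polygon close up. The
edges vary continuously as long as the squared third coordinates stay
nonnegative, and these are positive at one angle by hypothesis, hence near it. *)

Definition edge_x {R : realType} (theta l b b' : R) : R :=
  l * (cos b' - cos b) / (2 * sin theta).

Definition edge_y {R : realType} (theta l b b' : R) : R :=
  - (l * (cos b + cos b')) / (2 * cos theta).

Definition edge_height2 {R : realType} (theta l b b' : R) : R :=
  l ^+ 2 - edge_x theta l b b' ^+ 2 - edge_y theta l b b' ^+ 2.

(** Where [edge_height2] is negative, [Num.sqrt] returns 0: the vector is still defined there, but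
    its length is no longer [l]. *)
Definition signed_edge {R : realType} (s theta l b b' : R) : 'rV[R]_3 :=
  edge_x theta l b b' *: 'e_(0 : 'I_3) + edge_y theta l b b' *: 'e_(1 : 'I_3)
  + (s * Num.sqrt (edge_height2 theta l b b')) *: 'e_(2%R : 'I_3).

Lemma dot3E {R : realType} (x y : 'rV[R]_3) :
  dot3 x y = x 0 0 * y 0 0 + x 0 1 * y 0 1 + x 0 2%R * y 0 2%R.
Proof.
rewrite /dot3 !big_ord_recl big_ord0 addr0 addrA.
by congr (x 0 _ * y 0 _ + x 0 _ * y 0 _ + x 0 _ * y 0 _); apply: val_inj.
Qed.

Lemma signed_edgeE {R : realType} (s theta l b b' : R) :
  let e := signed_edge s theta l b b' in
  [/\ e 0 0 = edge_x theta l b b', e 0 1 = edge_y theta l b b' &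
      e 0 2%R = s * Num.sqrt (edge_height2 theta l b b')].
Proof.
by split; rewrite !mxE /= ?mulr1 ?mulr0 ?addr0 ?add0r.
Qed.

Lemma sin_cos_gt0 {R : realType} {theta : R} :
  0 < theta < pi / 2 -> 0 < sin theta /\ 0 < cos theta.
Proof.
move=> /andP[t0 t2]; have p0 := pi_gt0 R; split.
  by apply: sin_gt0_pi; rewrite t0 /=; lra.
by apply: cos_gt0_pihalf; rewrite t2 andbT; lra.
Qed.

(** Both tube directions have third coordinate 0, so [s] does not enter the scalar products, and the
    length sees only [s ^+ 2]. *)
Lemma signed_edge_vector {R : realType} (s theta l b b' : R) :
  0 < theta < pi / 2 -> 0 <= l -> s ^+ 2 = 1 ->
  0 <= edge_height2 theta l b b' ->
  edge_vector theta l b b' (signed_edge s theta l b b').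
Proof.
move=> /sin_cos_gt0[s0 c0] l0 s1 h0.
have [e0 e1 e2] := signed_edgeE s theta l b b'.
split.
- rewrite /enorm3 dot3E e0 e1 e2 (mulrACA s) -(expr2 s) s1 mul1r.
  rewrite -(expr2 (Num.sqrt _)) sqr_sqrtr // /edge_height2.
  set h := (X in Num.sqrt X); have -> : h = l ^+ 2 by rewrite /h; ring.
  by rewrite sqrtr_sqr ger0_norm.
- rewrite dot3E e0 e1 !mxE /= /edge_x /edge_y; field; lra.
- rewrite dot3E e0 e1 !mxE /= /edge_x /edge_y; field; lra.
Qed.

(** The scalar products force the first two coordinates of [e], so [edge_height2] is the square of
    the third; were that 0, [e] would lie in the plane of the two tube directions. *)
Lemma edge_height2_gt0 {R : realType} {theta l b b' : R} {e : 'rV[R]_3} :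
  0 < theta < pi / 2 -> edge_vector theta l b b' e ->
  (forall s t : R, e <> s *: uvec theta + t *: wvec theta) ->
  0 < edge_height2 theta l b b'.
Proof.
move=> /sin_cos_gt0[s0 c0] [el eu ew] eNuw.
move: eu ew; rewrite !dot3E !mxE /= !mulr0 !addr0 => eu ew.
have ex : e 0 0 = edge_x theta l b b'.
  rewrite /edge_x mulrBr -eu -ew; field; lra.
have ey : e 0 1 = edge_y theta l b b'.
  rewrite /edge_y mulrDr -eu -ew; field; lra.
have -> : edge_height2 theta l b b' = e 0 2%R ^+ 2.
  rewrite /edge_height2 -ex -ey -el sqr_sqrtr; last first.
    by rewrite dot3E -!expr2 !addr_ge0 ?sqr_ge0.
  by rewrite dot3E; ring.
rewrite lt0r sqr_ge0 andbT sqrf_eq0; apply/eqP => ez.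
(* These coefficients solve [(t - s) * sin theta = e 0 0] and [- (s + t) * cos theta = e 0 1]. *)
apply: (eNuw (- (e 0 0 / sin theta + e 0 1 / cos theta) / 2)
             ((e 0 0 / sin theta - e 0 1 / cos theta) / 2)).
apply/rowP => i; rewrite !mxE.
have [->|->|->] : [\/ i = 0, i = 1 | i = 2%R].
  case: i => -[|[|[|//]]] i3;
  [apply: Or31|apply: Or32|apply: Or33]; exact: val_inj.
- rewrite /=; field; lra.
- rewrite /=; field; lra.
- by rewrite ez /= !mulr0 addr0.
Qed.

Section continuity.
Context {R : realType} (l b b' theta : R).
Hypothesis htheta : 0 < theta < pi / 2.

Let s0 : sin theta != 0. Proof. by have [/lt0r_neq0] := sin_cos_gt0 htheta. Qed.
Let c0 : cos theta != 0. Proof. by have [_ /lt0r_neq0] := sin_cos_gt0 htheta. Qed.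

Lemma edge_x_continuous : {for theta, continuous (fun t => edge_x t l b b')}.
Proof.
apply: cvgM; first exact: cvg_cst.
apply: cvgV; first by rewrite mulf_neq0 ?pnatr_eq0.
by apply: cvgM; [exact: cvg_cst|exact: continuous_sin].
Qed.

Lemma edge_y_continuous : {for theta, continuous (fun t => edge_y t l b b')}.
Proof.
apply: cvgM; first exact: cvg_cst.
apply: cvgV; first by rewrite mulf_neq0 ?pnatr_eq0.
by apply: cvgM; [exact: cvg_cst|exact: continuous_cos].
Qed.

Lemma edge_height2_continuous :
  {for theta, continuous (fun t => edge_height2 t l b b')}.
Proof.
apply: cvgB; [apply: cvgB; first exact: cvg_cst|].
- by apply: cvgM; exact: edge_x_continuous.
- by apply: cvgM; exact: edge_y_continuous.
Qed.

Lemma signed_edge_continuous (s : R) :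
  {for theta, continuous (fun t => signed_edge s t l b b')}.
Proof.
apply: cvgD; [apply: cvgD|]; apply: cvgZr_tmp.
- exact: edge_x_continuous.
- exact: edge_y_continuous.
- apply: cvgM; first exact: cvg_cst.
  apply: (@continuous_comp _ _ _ (fun t => edge_height2 t l b b') Num.sqrt).
    exact: edge_height2_continuous.
  exact: sqrt_continuous.
Qed.

End continuity.

(** Taking partial sums as vertices, consecutive differences telescope; the vanishing total serves
    at the last index, whose successor is 0. *)
Lemma closed_polygon_edges {V : zmodType} {N : nat} (e : 'I_N -> V) :
  \sum_k e k = 0 ->
  forall k : 'I_N,
    \sum_(j < N | (j < ordS k)%N) e j - \sum_(j < N | (j < k)%N) e j = e k.
Proof.
move=> e0 k; apply/eqP; rewrite subr_eq; apply/eqP.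
have addk : e k + \sum_(j < N | (j < k)%N) e j = \sum_(j < N | (j < k.+1)%N) e j.
  rewrite [RHS](bigD1 k) //=; congr (_ + _); apply: eq_bigl => j.
  by rewrite ltnS ltn_neqAle andbC.
rewrite addk /=.
have [kN|] := ltnP k.+1 N; first by rewrite modn_small.
rewrite leq_eqVlt ltnNge ltn_ord orbF => /eqP kN.
rewrite -kN modnn big_pred0_eq -[LHS]e0.
by apply: eq_bigl => j; rewrite ltn_ord.
Qed.

Theorem mainTheorem3 (R : realType) (M : nat) (L beta B : 'I_(M + M) -> R)
    (hM : (2 <= M)%N)
    (hparams : juncture_params L beta B)
    (htype : type_II_OEE L beta B)
    (hbeta : \sum_(k < M) L (lshift M k) * cos (beta (lshift M k)) = 0)
    (hB : \sum_(k < M) L (lshift M k) * cos (B (lshift M k)) = 0)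
    (hreal : edges_realizable L beta B) :
  flexible L beta B.
Proof.
case: hparams => _ _ L0 _ _; case: hreal => t0 t0I ht0.
have good : \forall t \near t0, 0 < t < pi / 2 /\
    forall k, 0 < edge_height2 t (L k) (beta k) (B k).
  apply: filterI.
    have : t0 \in `]0, pi / 2[ by rewrite in_itv.
    by move/near_in_itvoo; apply: filterS => t; rewrite in_itv.
  have hk k : \forall t \near t0, 0 < edge_height2 t (L k) (beta k) (B k).
    have [e ek eN] := ht0 k.
    have h0 := edge_height2_gt0 t0I ek eN.
    exact: (edge_height2_continuous _ _ _ _ t0I _ (lt_nbhsr h0)).
  (* There are finitely many edges, so one neighbourhood serves them all. *)
  exact: (filter_forall (nbhs_filter t0) hk).
have [/= d d0 dgood] := (nbhs_ballP _ _).1 good.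
pose e (k : 'I_(M + M)) t :=
  signed_edge ((-1) ^+ (M <= k)%N) t (L k) (beta k) (B k).
have x0 t :
    \sum_(k < M) edge_x t (L (lshift M k)) (beta (lshift M k)) (B (lshift M k)) = 0.
  (* The denominator is common to all edges; what remains is the difference of the two continuity
     constraints. *)
  rewrite -mulr_suml; under eq_bigr do rewrite mulrBr.
  by rewrite sumrB hbeta hB subrr mul0r.
have y0 t :
    \sum_(k < M) edge_y t (L (lshift M k)) (beta (lshift M k)) (B (lshift M k)) = 0.
  rewrite -mulr_suml sumrN; under eq_bigr do rewrite mulrDr.
  by rewrite big_split /= hbeta hB addr0 oppr0 mul0r.
have e0 t : \sum_k e k t = 0.
  (* Edges [k] and [k + M] are added in pairs: their heights cancel and their planar parts
     double. *)
  rewrite big_split_ord /= -big_split /=.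
  under eq_bigr => k _.
    have [hL hb hB'] := htype k.
    rewrite /e /signed_edge /= hL hb hB' leq_addr leqNgt ltn_ord /=.
    rewrite expr0 expr1 mulN1r mul1r scaleNr addrACA subrr addr0 -mulr2n.
    over.
  by rewrite sumrMnl big_split /= -scaler_suml x0 -scaler_suml y0 !scale0r addr0 mul0rn.
exists `]t0 - d, t0 + d[%classic; rewrite -ball_itv; split.
- by rewrite ball_itv; exact: interval_is_interval.
- by move=> t /dgood[].
- exists t0, (t0 + d / 2); split; last by rewrite ltrDl divr_gt0.
    exact: ballxx.
  by rewrite ball_itv /= in_itv /=; apply/andP; split; lra.
(* The first vertex stays at the origin. *)
- exists (fun k t => \sum_(j < M + M | (j < k)%N) e j t); split => [k|t /dgood[tI ht] k].
    apply: continuous_in_subspaceT => t; rewrite inE => /dgood[tI _].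
    apply: cvg_big => [|j _]; first exact: add_continuous.
    exact: signed_edge_continuous.
  rewrite (closed_polygon_edges (fun k => e k t)) //.
  by apply: signed_edge_vector => //; rewrite ?sqrr_sign // ltW.
Qed.
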